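(* Let $T$ be a closed triangle in the plane $\mathbb{R}^2$, and let $\mathcal{F}_1, \mathcal{F}_2, \mathcal{F}_3$ be three non-empty finite families of translates of $T$. Suppose that $K' \cap K'' \neq \varnothing$ for every pair $(K', K'')$ such that $K' \in \mathcal{F}_i$, $K'' \in \mathcal{F}_j$ and $i \neq j$. Then there exists $m \in \{1,2,3\}$ such that $\pi(\mathcal{F}_m) \le 3$.
   Context: For a family $\mathcal{F}$ of convex sets in $\mathbb{R}^d$, the piercing number $\pi(\mathcal{F})$ is the smallest positive integer $k$ such that there is a set of $k$ points in $\mathbb{R}^d$ that intersects every element of $\mathcal{F}$. Thus $\pi(\mathcal{F}) \le 3$ means that there are three points such that every member of $\mathcal{F}$ contains at least one of them. A translate of $T$ is a set of the form $T + t = \{a + t : a \in T\}$ with $t \in \mathbb{R}^2$. *)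

(* Defs.v *)
From HB Require Import structures.
From mathcomp Require Export all_boot all_order all_algebra.
From mathcomp Require Export boolp classical_sets functions cardinality reals.

Set Implicit Arguments.
Unset Strict Implicit.
Unset Printing Implicit Defensive.

Import Order.TTheory GRing.Theory Num.Theory.
Local Open Scope classical_set_scope.
Local Open Scope ring_scope.

Section Plane.
Variable R : realType.

Definition triangle (a b c : 'rV[R]_2) : set 'rV[R]_2 :=
  [set x | exists u v w : R,
    [/\ 0 <= u, 0 <= v, 0 <= w, u + v + w = 1
      & x = u *: a + v *: b + w *: c]].

(* [free] says that the three vertices are affinely independent, so that
   degenerate triangles (segments and points) are excluded. *)
Definition closed_triangle (T : set 'rV[R]_2) : Prop :=
  exists a b c : 'rV[R]_2, free [:: b - a; c - a] /\ T = triangle a b c.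

End Plane.

Section Piercing.
Variables (R : realType) (d : nat).
Implicit Types (T K P : set 'rV[R]_d) (F : set (set 'rV[R]_d)) (k : nat).

Definition translate_of T K : Prop :=
  exists t : 'rV[R]_d, K = [set a + t | a in T].

Definition pierces P F : Prop := forall K, F K -> K `&` P !=set0.

Definition pierced_by_card F k : Prop :=
  exists P, (P #= `I_k)%card /\ pierces P F.

(* [piercing_number F k] is the relation pi(F) = k; a family that no finite set
   pierces has no piercing number. *)
Definition piercing_number F k : Prop :=
  [/\ (0 < k)%N, pierced_by_card F k
    & forall j, (0 < j)%N -> pierced_by_card F j -> (k <= j)%N].

End Piercing.

(* Main.v *)
Require Import Defs.
From mathcomp Require Import all_boot all_order all_algebra.
From mathcomp Require Import boolp classical_sets functions cardinality reals.
From mathcomp Require Import lra.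

(** In the affine coordinates [X], [Y] in which the triangle is [0 <= X],
    [0 <= Y], [X + Y <= 1], let the three widths of a family be the lengths of
    the ranges of [X], [Y] and [X + Y] on its translation vectors. For each of
    these functionals the cross-intersection hypothesis bounds
    (max over one family) - (min over another) by 1; summing cyclically, the
    widths of the three families add up to at most 3. Hence the nine widths add
    up to at most 9, and some family has its three widths of sum at most 3.
    Such a family is pierced by three explicit points. *)

Set Implicit Arguments.
Unset Strict Implicit.

Local Open Scope classical_set_scope.
Local Open Scope ring_scope.
Import Order.TTheory GRing.Theory Num.Theory.

Section Ranges.
Variables (R : realType) (V : Type).

(** With at least two families the cyclic successor [i + 1] differs from [i], so the supremum over
    [A i] exceeds the infimum over [A (i + 1)] by at most 1. *)
Lemma cross_close_ranges (n : nat) (A : 'I_n.+2 -> set V) (g : V -> R) :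
  (forall i, A i !=set0) ->
  (forall i j s t, i != j -> A i s -> A j t -> g s - g t <= 1) ->
  exists lo hi : 'I_n.+2 -> R,
    (forall i t, A i t -> lo i <= g t <= hi i) /\
    \sum_i (hi i - lo i) <= n.+2%:R.
Proof.
move=> A0 close.
have neqS (i : 'I_n.+2) : i != i + 1.
  by rewrite -[X in X != _]addr0 (inj_eq (addrI i)) eq_sym oner_eq0.
have ubA i : has_ubound (g @` A i).
  have [t At] := A0 (i + 1); exists (g t + 1) => _ [s As <-].
  by rewrite addrC -lerBlDr; exact: close At.
have lbA i : has_lbound (g @` A i).
  have [s As] := A0 (i + 1); exists (g s - 1) => _ [t At <-].
  by rewrite lerBlDr -lerBlDl; apply: close As At; rewrite eq_sym.
exists (fun i => inf (g @` A i)), (fun i => sup (g @` A i)); split.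
  move=> i t At; apply/andP; split.
    by apply: ge_inf => //; exists t.
  by apply: ub_le_sup => //; exists t.
(* Shifting the infima cyclically keeps their sum and pairs each supremum with the next infimum. *)
rewrite sumrB (reindex_inj (addIr (1 : 'I_n.+2))
  (F := fun i => inf (g @` A i))) -sumrB /=.
have -> : n.+2%:R = \sum_(i < n.+2) 1 :> R by rewrite sumr_const card_ord.
apply: ler_sum => i _; rewrite lerBlDr.
apply: ge_sup => [|_ [s As <-]]; first by have [s As] := A0 i; exists (g s), s.
rewrite -lerBlDl; apply: lb_le_inf => [|_ [t At <-]].
  by have [t At] := A0 (i + 1); exists (g t), t.
by rewrite lerBlDl -lerBlDr; exact: close As At.
Qed.

Lemma small_total_range (A : 'I_3 -> set V) (X Y : V -> R) :
  (forall i, A i !=set0) ->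
  (forall i j s t, i != j -> A i s -> A j t ->
    [/\ X s - X t <= 1, Y s - Y t <= 1
      & (X s + Y s) - (X t + Y t) <= 1]) ->
  exists m x x' y y' z z', [/\ forall t, A m t -> x <= X t <= x',
    forall t, A m t -> y <= Y t <= y',
    forall t, A m t -> z <= X t + Y t <= z'
    & (x' - x) + (y' - y) + (z' - z) <= 3].
Proof.
move=> A0 close.
have [x [x' [bX wx]]] : exists lo hi : 'I_3 -> R,
    (forall i t, A i t -> lo i <= X t <= hi i) /\ \sum_i (hi i - lo i) <= 3.
  by apply: cross_close_ranges => // i j s t ij As At; case: (close i j s t).
have [y [y' [bY wy]]] : exists lo hi : 'I_3 -> R,
    (forall i t, A i t -> lo i <= Y t <= hi i) /\ \sum_i (hi i - lo i) <= 3.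
  by apply: cross_close_ranges => // i j s t ij As At; case: (close i j s t).
have [z [z' [bZ wz]]] : exists lo hi : 'I_3 -> R,
    (forall i t, A i t -> lo i <= X t + Y t <= hi i) /\
    \sum_i (hi i - lo i) <= 3.
  by apply: cross_close_ranges => // i j s t ij As At; case: (close i j s t).
pose w i := (x' i - x i) + (y' i - y i) + (z' i - z i).
have [m wm] : exists m, w m <= 3.
  apply: contrapT => /forallNP w3.
  have : \sum_(i < 3) w i <= \sum_(i < 3) 3.
    by rewrite sumr_const card_ord -mulr_natr !big_split /= in wx wy wz *; lra.
  apply/negP; rewrite -ltNge; apply: ltr_sum => [|i _].
    by apply/hasP; exists ord0 => //; rewrite mem_index_enum.
  by rewrite ltNge; apply/negP/w3.
by exists m, (x m), (x' m), (y m), (y' m), (z m), (z' m); split; auto.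
Qed.

(* The translate by [t] contains [(p, q)] iff [X t <= p], [Y t <= q] and
   [p + q - 1 <= X t + Y t]. The first point handles the lower part
   [X + Y <= x + y + v]; on the rest, [v] makes its bound [x + y + v] the active
   lower bound [p + q - 1] for both other points, and a translate missed by both
   would have [X + Y > z']. *)
Lemma three_cover (A : set V) (X Y : V -> R) (x x' y y' z z' : R) :
  (forall t, A t -> x <= X t <= x') ->
  (forall t, A t -> y <= Y t <= y') ->
  (forall t, A t -> z <= X t + Y t <= z') ->
  (x' - x) + (y' - y) + (z' - z) <= 3 ->
  exists p q : 'I_3 -> R, forall t, A t ->
    exists i, [/\ X t <= p i, Y t <= q i & p i + q i - 1 <= X t + Y t].
Proof.
move=> bX bY bZ w.
(* This value gives the first point [p + q - 1 = z], a bound met on all of [A]. *)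
pose v := (1 + z - x - y) / 2.
pose p (i : 'I_3) := [:: x + v; x'; x + (v + 1 - (y' - y))]`_i.
pose q (i : 'I_3) := [:: y + v; y + (v + 1 - (x' - x)); y']`_i.
exists p, q => t At.
have {bX}/andP[x1 x2] := bX t At.
have {bY}/andP[y1 y2] := bY t At.
have {bZ}/andP[z1 z2] := bZ t At.
have [le_v|gt_v] := leP (X t + Y t) (x + y + v).
  exists (@Ordinal 3 0 isT).
  by rewrite /p /q /=; split; rewrite /v in le_v *; lra.
have [le_y|gt_y] := leP (Y t) (y + (v + 1 - (x' - x))).
  exists (@Ordinal 3 1 isT).
  by rewrite /p /q /=; split; rewrite /v in gt_v le_y *; lra.
exists (@Ordinal 3 2 isT).
by rewrite /p /q /=; split; rewrite /v in gt_v gt_y *; lra.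
Qed.

End Ranges.

Lemma plane_coordinates (K : fieldType) (V : vectType K) (e1 e2 : V) :
  dim V = 2 -> free [:: e1; e2] ->
  exists X Y : {scalar V},
    forall t p q, t = p *: e1 + q *: e2 <-> X t = p /\ Y t = q.
Proof.
move=> dimV fe.
pose e := [tuple e1; e2].
have be : basis_of fullv e by rewrite basisEfree fe subvf dimvf dimV.
exists (coord e 0), (coord e 1) => t p q.
have eq0 : coord e 0 e1 = 1 by rewrite (coord_free 0 0 fe).
have eq1 : coord e 1 e1 = 0 by rewrite (coord_free 0 1 fe).
have eq2 : coord e 0 e2 = 0 by rewrite (coord_free 1 0 fe).
have eq3 : coord e 1 e2 = 1 by rewrite (coord_free 1 1 fe).
split=> [->|[<- <-]].
  by rewrite !linearD !linearZ /= eq0 eq1 eq2 eq3 !mulr0 !mulr1 addr0 add0r.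
rewrite {1}(coord_basis be (memvf t)) big_ord_recl big_ord1.
by congr (_ + coord _ _ _ *: _); exact: val_inj.
Qed.

(** The three inequalities state that the barycentric coordinates of [x - t] at [b], [c] and [a] are
    nonnegative. *)
Lemma mem_translate_triangle (R : realType) (a b c : 'rV[R]_2)
    (X Y : {scalar 'rV[R]_2}) :
  (forall t p q, t = p *: (b - a) + q *: (c - a) <-> X t = p /\ Y t = q) ->
  forall t x, [set s + t | s in triangle a b c] x <->
    [/\ X t <= X (x - a), Y t <= Y (x - a)
      & X (x - a) + Y (x - a) - 1 <= X t + Y t].
Proof.
move=> XY t x; split.
  move=> [_ [u [v [w [u0 v0 w0 uvw ->]]]] <-].
  have -> : u *: a + v *: b + w *: c + t - a
          = v *: (b - a) + w *: (c - a) + t.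
    have -> : u = 1 - v - w by lra.
    rewrite !scalerBr !scalerBl scale1r.
    by apply/rowP=> i; rewrite !mxE; lra.
  have [Xe Ye] := (XY _ v w).1 erefl.
  by rewrite (linearD X) (linearD Y) Xe Ye; split; lra.
move=> [X1 Y1 Z1]; exists (x - t); last by rewrite subrK.
pose v := X (x - t - a); pose w := Y (x - t - a).
have ev : v = X (x - a) - X t by rewrite /v addrAC linearB.
have ew : w = Y (x - a) - Y t by rewrite /w addrAC linearB.
exists (1 - v - w), v, w; split; [lra|lra|lra|lra|].
have /eqP := (XY (x - t - a) v w).2 (conj erefl erefl).
rewrite subr_eq => /eqP ->.
by apply/rowP=> i; rewrite !mxE; lra.
Qed.

(** Since [f] may repeat points, its range has some cardinality [j <= n], positive because [F] has a
    member; the least admissible cardinality is then the piercing number. *)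
Lemma piercing_number_le (R : realType) (d n : nat) (F : set (set 'rV[R]_d))
    (f : 'I_n -> 'rV[R]_d) :
  F !=set0 -> (forall K, F K -> exists i, K (f i)) ->
  exists2 k, piercing_number F k & (k <= n)%N.
Proof.
move=> [K FK] pf.
pose P k := `[< (0 < k)%N /\ pierced_by_card F k >].
have [j Pj jn] : exists2 j, P j & (j <= n)%N.
  have fin : finite_set (range f) by apply: finite_image; exact: finite_finset.
  have [j fj] := (finite_setP _).1 fin.
  exists j.
    apply/asboolP; split.
      rewrite lt0n; apply/eqP => j0; have [i _] := pf K FK.
      have : range f = set0 by apply/eqP; rewrite j0 II0 card_eq0 in fj.
      by rewrite -subset0 => /(_ (f i)) /=; apply; exists i.
    exists (range f); split=> // L /pf[i Li].
    by exists (f i); split=> //; exists i.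
  rewrite -card_le_II -(card_le_eql fj).
  by rewrite (card_le_eqr card_II) card_image_le.
have exP : exists k, P k by exists j.
have [k /asboolP[k0 pk] mink] := ex_minnP exP.
exists k; last exact: leq_trans (mink j Pj) jn.
by split=> // i i0 pi; apply: mink; apply/asboolP.
Qed.

Theorem theorem1p3 (R : realType) (T : set 'rV[R]_2)
    (F : 'I_3 -> set (set 'rV[R]_2)) :
  closed_triangle T ->
  (forall i, F i !=set0) ->
  (forall i, finite_set (F i)) ->
  (forall i K, F i K -> translate_of T K) ->
  (forall i j K' K'', i != j -> F i K' -> F j K'' -> K' `&` K'' !=set0) ->
  exists m : 'I_3, exists2 k : nat, piercing_number (F m) k & (k <= 3)%N.
Proof.
move=> [a [b [c [fe ->]]]] F0 _ trF meetF.
have [X [Y XY]] := plane_coordinates (dim_matrix R 1 2) fe.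
have memT := mem_translate_triangle XY.
pose A i := [set t | F i [set s + t | s in triangle a b c]].
have A0 i : A i !=set0.
  have [K FK] := F0 i; have [t Kt] := trF i K FK.
  by exists t; rewrite /A /= -Kt.
have [|m [x [x' [y [y' [z [z' [bX bY bZ w]]]]]]]] :=
  small_total_range (X := X) (Y := Y) A0.
  move=> i j s t ij As At.
  (* At a common point [u], [X s <= X (u - a)], while the bounds on [X t + Y t] and [Y t] force
     [X (u - a) - 1 <= X t]; [Y] is symmetric, and [X + Y] is direct. *)
  have [u [/memT[? ? ?] /memT[? ? ?]]] := meetF i j _ _ ij As At.
  by split; lra.
have [p [q pq]] := three_cover bX bY bZ w.
exists m.
(* The pairs [p i], [q i] are coordinates with the vertex [a] as origin. *)
apply: (piercing_number_le
  (f := fun i => a + (p i *: (b - a) + q i *: (c - a)))) => //.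
move=> K FK; have [t Kt] := trF m K FK.
have [i [? ? ?]] : exists i,
    [/\ X t <= p i, Y t <= q i & p i + q i - 1 <= X t + Y t].
  by apply: pq; rewrite /A /= -Kt.
exists i; rewrite Kt; apply/memT.
rewrite addrAC subrr add0r.
by have [-> ->] := (XY _ (p i) (q i)).1 erefl.
Qed.
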